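(* For all integers $k\ge1$, $$\sqrt{2\pi}\,L_k\,f(k)\;\le\;\Delta_{k+1}\;\le\;\sqrt{2\pi}\,R_k\,f(k),$$ where $$f(k)=\int_0^1 \frac{e^{\frac{(u-\frac12)^2}{4k}}\,u(1-u)}{(k+u)^{3/2}}\,du, \qquad L_k=e^{\frac{1}{12k+1}-\frac{1}{8k}}, \qquad R_k=e^{\frac{1}{48k}}.$$
   Context: The Stieltjes partial approximation error is, for real $x>e$, $$\Delta(x) = \int_{e^{n}}^{x}\frac{n!}{\ln^{n+1}(t)}\,dt - \frac{(\ln(x)-n)\,x\,n!}{\ln^{n+1}(x)}, \qquad n=\lceil\ln(x)\rceil-1,$$ where $\ln^m(x)$ means $(\ln x)^m$, and $\Delta_k=\Delta(e^k)$ for integers $k\ge2$ (so for $x=e^k$ one has $n=k-1$). *)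

(* Defs.v *)
From Stdlib Require Import Reals ZArith.
From Coquelicot Require Import Coquelicot.
Open Scope R_scope.

(* [Int_part] is the floor function. *)
Definition ceil (x : R) : Z := (- Int_part (- x))%Z.

(* For [x > exp 1] the integer [ceil (ln x) - 1] is at least 1,
   so [Z.to_nat] does not truncate. *)
Definition stieltjes_n (x : R) : nat := Z.to_nat (ceil (ln x) - 1).

(* Meaningful for [x > exp 1]. *)
Definition Stieltjes_Delta (x : R) : R :=
  let n := stieltjes_n x in
  RInt (fun t => INR (fact n) / (ln t) ^ (n + 1)) (exp (INR n)) x
  - (ln x - INR n) * x * INR (fact n) / (ln x) ^ (n + 1).

Definition Delta_k (k : nat) : R := Stieltjes_Delta (exp (INR k)).

Definition f_int (k : nat) : R :=
  RInt (fun u => exp ((u - 1 / 2) ^ 2 / (4 * INR k)) * (u * (1 - u))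
                 / Rpower (INR k + u) (3 / 2)) 0 1.

Definition L_coef (k : nat) : R := exp (1 / (12 * INR k + 1) - 1 / (8 * INR k)).

Definition R_coef (k : nat) : R := exp (1 / (48 * INR k)).

(* Main.v *)
Require Import Defs.
From Stdlib Require Import Reals Factorial Lra Lia.
From Coquelicot Require Import Coquelicot.
Open Scope R_scope.

(* Substituting [t = exp (k + u)] and integrating by parts turns Delta_{k+1} into
   the integral over [0,1] of [k! e^(k+u) u (1-u) / (k+u)^(k+2)].  Write
   [k! = sqrt (2 pi) k^(k+1/2) e^(-k+theta)], where [1/(12k+1) <= theta <= 1/(12k)]
   (Robbins).  The integrand becomes
   [sqrt (2 pi) e^(theta+h(u)) u (1-u) / (k+u)^(3/2)] with
   [h(u) = u - (k+1/2) ln (1+u/k)], and [h(u) - (u^2-u)/(4k)] has derivative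
   [(u-1/2) (1/(k+u) - 1/(2k))], so it is minimal at [u = 1/2] and maximal at an
   end point; hence [-1/(8k) <= h(u) - (u-1/2)^2/(4k) <= -1/(16k)].

   For Robbins' bounds, the increments of [ln k! - (k+1/2) ln k + k] are estimated
   through the series of artanh at [1/(2k+1)], and the constant is found from
   Wallis' integrals. *)

(** * Monotonicity and inequalities for logarithms *)

Lemma is_derive_nonneg_le (f df : R -> R) (a b : R) :
  a <= b -> (forall x, a <= x <= b -> is_derive f x (df x)) ->
  (forall x, a <= x <= b -> 0 <= df x) -> f a <= f b.
Proof.
  intros hab hd hp.
  destruct (MVT_gen f a b df) as [c [hc heq]];
    rewrite ?Rmin_left, ?Rmax_right in * by lra.
  - intros x hx; apply hd; lra.
  - intros x hx; apply continuity_pt_filterlim.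
    apply (ex_derive_continuous (V := R_NormedModule) f x).
    exists (df x); apply hd; lra.
  - specialize (hp c hc); nra.
Qed.

Lemma exp_monotone (x y : R) : x <= y -> exp x <= exp y.
Proof.
  intros [h | ->]; [left; now apply exp_increasing | apply Rle_refl].
Qed.

Lemma ln_1p_le (x : R) : 0 <= x -> ln (1 + x) <= x.
Proof.
  intros hx.
  rewrite <- (ln_exp x) at 2.
  apply ln_le; [lra | apply exp_ineq1_le].
Qed.

(** Two terms of the artanh series: the difference has derivative
    [1/(1-x^2) - (1+x^2) = x^4/(1-x^2)]. *)
Lemma atanh_lower (x : R) : 0 <= x < 1 ->
  x + x ^ 3 / 3 <= / 2 * (ln (1 + x) - ln (1 - x)).
Proof.
  intros hx.
  set (f := fun x => / 2 * (ln (1 + x) - ln (1 - x)) - (x + x ^ 3 / 3)).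
  assert (h : f 0 <= f x).
  { apply is_derive_nonneg_le with (fun x => x ^ 4 / (1 - x ^ 2)); [lra | |].
    - intros y hy; unfold f; auto_derive; [lra | field]; repeat split; nra.
    - intros y hy; apply Rdiv_le_0_compat; [nra | nra]. }
  unfold f in h; rewrite Rplus_0_r, Rminus_0_r, ln_1 in h; lra.
Qed.

(** The tail [x^3/3 + x^5/5 + ...] is dominated by the geometric series of first term [x^3/3] and
    ratio [x^2]. *)
Lemma atanh_upper (x : R) : 0 <= x < 1 ->
  / 2 * (ln (1 + x) - ln (1 - x)) <= x + x ^ 3 / (3 * (1 - x ^ 2)).
Proof.
  intros hx.
  set (f := fun x => x + x ^ 3 / (3 * (1 - x ^ 2))
                     - / 2 * (ln (1 + x) - ln (1 - x))).
  assert (h : f 0 <= f x).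
  { apply is_derive_nonneg_le with (fun x => 2 * x ^ 4 / (3 * (1 - x ^ 2) ^ 2));
      [lra | |].
    - intros y hy; unfold f; auto_derive; [|field]; repeat split; nra.
    - intros y hy; apply Rdiv_le_0_compat; [nra |].
      assert (0 < 1 - y ^ 2) by nra.
      apply Rmult_lt_0_compat; [lra | now apply pow_lt]. }
  unfold f in h; rewrite Rplus_0_r, Rminus_0_r, ln_1 in h; lra.
Qed.

(** * Increments of the Stirling sequence *)

Lemma ln_succ_sub (x : R) : 0 < x ->
  ln (x + 1) - ln x = ln (1 + / (2 * x + 1)) - ln (1 - / (2 * x + 1)).
Proof.
  intros hx.
  assert (hy : / (2 * x + 1) < 1).
  { rewrite <- Rinv_1; apply Rinv_lt_contravar; lra. }
  assert (0 < / (2 * x + 1)) by (apply Rinv_0_lt_compat; lra).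
  rewrite <- !ln_div by lra.
  (* For [y = 1/(2x+1)], the quotient [(1+y)/(1-y)] is [(x+1)/x]. *)
  f_equal; field; lra.
Qed.

Lemma stirling_step_lower (x : R) : 1 <= x ->
  1 / (12 * x + 1) - 1 / (12 * (x + 1) + 1)
  <= (x + / 2) * (ln (x + 1) - ln x) - 1.
Proof.
  intros hx; rewrite ln_succ_sub by lra.
  assert (hy : / (2 * x + 1) < 1).
  { rewrite <- Rinv_1; apply Rinv_lt_contravar; lra. }
  assert (hy0 : 0 < / (2 * x + 1)) by (apply Rinv_0_lt_compat; lra).
  pose proof (atanh_lower (/ (2 * x + 1)) ltac:(lra)) as h.
  apply Rle_trans with
    ((2 * x + 1) * (/ (2 * x + 1) + (/ (2 * x + 1)) ^ 3 / 3) - 1).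
  2: { apply (Rmult_le_compat_l (2 * x + 1)) in h; lra. }
  apply Rminus_le_0.
  (* The artanh bound leaves [1/(3(2x+1)^2)]; subtracting [12/((12x+1)(12x+13))] gives the numerator
     [24x - 23], positive because [1 <= x]. *)
  replace (_ - _) with
    ((24 * x - 23) / (3 * (2 * x + 1) ^ 2 * (12 * x + 1) * (12 * x + 13)))
    by (field; lra).
  apply Rdiv_le_0_compat; [lra |].
  repeat apply Rmult_lt_0_compat; lra.
Qed.

Lemma stirling_step_upper (x : R) : 0 < x ->
  (x + / 2) * (ln (x + 1) - ln x) - 1
  <= 1 / (12 * x) - 1 / (12 * (x + 1)).
Proof.
  intros hx; rewrite ln_succ_sub by lra.
  assert (hy : / (2 * x + 1) < 1).
  { rewrite <- Rinv_1; apply Rinv_lt_contravar; lra. }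
  assert (hy0 : 0 < / (2 * x + 1)) by (apply Rinv_0_lt_compat; lra).
  pose proof (atanh_upper (/ (2 * x + 1)) ltac:(lra)) as h.
  set (y := / (2 * x + 1)) in *.
  (* The geometric bound telescopes exactly: [y^2/(3(1-y^2)) = 1/(12x(x+1))]. *)
  replace (1 / (12 * x) - 1 / (12 * (x + 1))) with
    ((2 * x + 1) * (y + y ^ 3 / (3 * (1 - y ^ 2))) - 1).
  - apply (Rmult_le_compat_l (2 * x + 1)) in h; lra.
  - unfold y; field; repeat split; nra.
Qed.

(** * Wallis integrals *)

Definition wallis (n : nat) : R := RInt (fun x => sin x ^ n) 0 (PI / 2).

Lemma ex_RInt_sin_pow (n : nat) (a b : R) : ex_RInt (fun x => sin x ^ n) a b.
Proof.
  apply (ex_RInt_continuous (V := R_CompleteNormedModule)); intros x _.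
  apply (ex_derive_continuous (V := R_NormedModule) (fun x => sin x ^ n)).
  auto_derive; trivial.
Qed.

(** [- cos x * sin x ^ (n + 1)] vanishes at both ends, so its derivative has integral 0; replacing
    [cos^2] by [1 - sin^2] there gives the recurrence. *)
Lemma wallis_rec (n : nat) :
  (INR n + 2) * wallis (n + 2) = (INR n + 1) * wallis n.
Proof.
  set (df := fun x => (INR n + 2) * sin x ^ (n + 2) - (INR n + 1) * sin x ^ n).
  assert (h : is_RInt df 0 (PI / 2)
    (minus ((fun x => - cos x * sin x ^ (n + 1)) (PI / 2))
           ((fun x => - cos x * sin x ^ (n + 1)) 0))).
  { apply (is_RInt_derive (V := R_CompleteNormedModule)
      (fun x => - cos x * sin x ^ (n + 1))).
    - intros x _; unfold df; auto_derive; trivial.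
      replace (Init.Nat.pred (n + 1)) with n by lia.
      rewrite !pow_add, plus_INR; simpl INR; simpl (_ ^ 2); simpl (_ ^ 1).
      pose proof (sin2_cos2 x) as e; unfold Rsqr in e.
      transitivity (sin x ^ n * (sin x * sin x)
                    - (INR n + 1) * (cos x * cos x) * sin x ^ n); [ring |].
      replace (cos x * cos x) with (1 - sin x * sin x) by lra.
      ring.
    - intros x _; apply (ex_derive_continuous (V := R_NormedModule) df).
      unfold df; auto_derive; trivial. }
  apply (is_RInt_unique (V := R_CompleteNormedModule)) in h.
  unfold minus, plus, opp in h; simpl in h.
  rewrite cos_PI2, sin_0, (pow_i (n + 1)) in h by lia.
  assert (h2 : RInt df 0 (PI / 2) =
    (INR n + 2) * wallis (n + 2) - (INR n + 1) * wallis n).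
  { apply (is_RInt_unique (V := R_CompleteNormedModule)).
    apply (is_RInt_minus (V := R_NormedModule)
      (fun x => (INR n + 2) * sin x ^ (n + 2)) (fun x => (INR n + 1) * sin x ^ n));
      apply (is_RInt_scal (V := R_NormedModule) (fun x => sin x ^ _));
      apply (RInt_correct (V := R_CompleteNormedModule)), ex_RInt_sin_pow. }
  lra.
Qed.

Lemma wallis_0 : wallis 0 = PI / 2.
Proof.
  unfold wallis; simpl.
  rewrite RInt_const; unfold scal; simpl; unfold mult; simpl; lra.
Qed.

Lemma wallis_1 : wallis 1 = 1.
Proof.
  unfold wallis.
  apply (is_RInt_unique (V := R_CompleteNormedModule)).
  replace 1 with (minus ((fun x => - cos x) (PI / 2)) ((fun x => - cos x) 0)).
  2: { unfold minus, plus, opp; simpl; rewrite cos_PI2, cos_0; lra. }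
  apply (is_RInt_derive (V := R_CompleteNormedModule)
      (fun x => - cos x)).
  - intros x _; auto_derive; trivial; simpl; ring.
  - intros x _; apply (ex_derive_continuous (V := R_NormedModule)).
    auto_derive; trivial.
Qed.

Lemma wallis_decr (n : nat) : wallis (n + 1) <= wallis n.
Proof.
  pose proof PI_RGT_0.
  apply RInt_le; try apply ex_RInt_sin_pow; [lra |].
  intros x hx.
  assert (0 <= sin x) by (apply sin_ge_0; lra).
  pose proof (pow_le (sin x) n H0).
  pose proof (SIN_bound x).
  rewrite pow_add; simpl; nra.
Qed.

(** By the recurrence, [(n+1) W_n W_(n+1)] does not depend on [n]; at [n = 0] it is [PI/2]. *)
Lemma wallis_mul_succ (n : nat) :
  wallis n * wallis (n + 1) = PI / (2 * (INR n + 1)).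
Proof.
  induction n as [|n IH].
  - change (0 + 1)%nat with 1%nat.
    rewrite wallis_0, wallis_1; simpl; field.
  - pose proof (pos_INR n).
    pose proof (wallis_rec n) as r.
    replace (S n + 1)%nat with (n + 2)%nat by lia.
    replace (S n) with (n + 1)%nat at 1 by lia.
    replace (wallis (n + 2)) with ((INR n + 1) * wallis n / (INR n + 2)).
    2: { rewrite <- r; field; lra. }
    transitivity ((INR n + 1) / (INR n + 2) * (wallis n * wallis (n + 1))).
    + field; lra.
    + rewrite IH, S_INR; field; lra.
Qed.

Lemma wallis_even (n : nat) :
  wallis (2 * n) = PI / 2 * INR (fact (2 * n)) / (4 ^ n * INR (fact n) ^ 2).
Proof.
  induction n as [|n IH].
  - change (2 * 0)%nat with 0%nat; rewrite wallis_0; simpl; field.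
  - pose proof (pos_INR n).
    pose proof (wallis_rec (2 * n)) as r.
    pose proof (INR_fact_neq_0 n).
    replace (2 * S n)%nat with (2 * n + 2)%nat by lia.
    replace (wallis (2 * n + 2)) with
      ((INR (2 * n) + 1) * wallis (2 * n) / (INR (2 * n) + 2)).
    2: { rewrite <- r; field; rewrite mult_INR; simpl; lra. }
    replace (2 * n + 2)%nat with (S (S (2 * n))) by lia.
    assert (e2 : INR (2 * n) = 2 * INR n) by now rewrite mult_INR.
    rewrite IH, (fact_simpl n), (fact_simpl (S _)), (fact_simpl (2 * n)).
    rewrite (mult_INR (S n)), (mult_INR (S (S (2 * n)))), (mult_INR (S (2 * n))).
    rewrite !S_INR, e2; simpl (4 ^ S n).
    assert (h4 : 4 ^ n <> 0) by (apply pow_nonzero; lra).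
    generalize dependent (4 ^ n); intros p _ hp.
    field; repeat split; lra.
Qed.

Lemma wallis_even_pos (n : nat) : 0 < wallis (2 * n).
Proof.
  rewrite wallis_even.
  pose proof PI_RGT_0.
  pose proof (INR_fact_lt_0 n); pose proof (INR_fact_lt_0 (2 * n)).
  apply Rdiv_lt_0_compat; [nra |].
  apply Rmult_lt_0_compat; apply pow_lt; lra.
Qed.

(** Since [W] decreases, the square lies between [W_(2n) W_(2n+1)] and [W_(2n-1) W_(2n)], both known
    exactly. *)
Lemma wallis_even_sq (n : nat) : (1 <= n)%nat ->
  PI / (2 * (2 * INR n + 1)) <= wallis (2 * n) ^ 2 <= PI / (4 * INR n).
Proof.
  intros hn.
  pose proof (wallis_even_pos n).
  pose proof (wallis_decr (2 * n)) as h1.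
  pose proof (wallis_mul_succ (2 * n)) as e1.
  pose proof (wallis_decr (2 * n - 1)) as h2.
  pose proof (wallis_mul_succ (2 * n - 1)) as e2.
  replace (2 * n - 1 + 1)%nat with (2 * n)%nat in * by lia.
  rewrite minus_INR in e2 by lia; rewrite mult_INR in e1, e2; simpl INR in e1, e2.
  change (1 + 1) with 2 in e1, e2.
  rewrite <- e1.
  replace (4 * INR n) with (2 * (2 * INR n - 1 + 1)) by ring.
  rewrite <- e2, <- Rsqr_pow2; unfold Rsqr.
  split; [apply Rmult_le_compat_l | apply Rmult_le_compat_r]; lra.
Qed.

(** * Stirling's constant and Robbins' bounds *)

Definition stirling (n : nat) : R :=
  ln (INR (fact n)) - (INR n + / 2) * ln (INR n) + INR n.

Lemma stirling_succ (n : nat) : (1 <= n)%nat ->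
  stirling n - stirling (n + 1)
  = (INR n + / 2) * (ln (INR n + 1) - ln (INR n)) - 1.
Proof.
  intros hn; unfold stirling.
  pose proof (lt_0_INR n ltac:(lia)).
  pose proof (INR_fact_lt_0 n).
  replace (n + 1)%nat with (S n) by lia.
  rewrite fact_simpl, mult_INR, S_INR, ln_mult by lra; ring.
Qed.

Lemma stirling_sub (m d : nat) : (1 <= m)%nat ->
  1 / (12 * INR m + 1) - 1 / (12 * INR (m + d) + 1)
  <= stirling m - stirling (m + d)
  <= 1 / (12 * INR m) - 1 / (12 * INR (m + d)).
Proof.
  intros hm; induction d as [|d IH].
  - rewrite Nat.add_0_r; lra.
  - pose proof (stirling_succ (m + d) ltac:(lia)) as e.
    assert (1 <= INR (m + d)) by (apply (le_INR 1); lia).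
    pose proof (stirling_step_lower (INR (m + d)) ltac:(lra)).
    pose proof (stirling_step_upper (INR (m + d)) ltac:(lra)).
    replace (m + S d)%nat with (m + d + 1)%nat by lia.
    rewrite (plus_INR (m + d) 1); simpl (INR 1); lra.
Qed.

(** This combination has the same limit as [stirling] itself, and its factorials enter as
    [n!^2/(2n)!], the ratio in [wallis_even]. The [n ln n] terms cancel, and [2n ln 2] is absorbed
    by [4^n]. *)
Lemma stirling_wallis (n : nat) : (1 <= n)%nat ->
  2 * stirling n - stirling (2 * n) = ln (PI / 2) - ln (wallis (2 * n))
                                      - ln (INR n) / 2 + ln 2 / 2.
Proof.
  intros hn.
  pose proof PI_RGT_0.
  pose proof (INR_fact_lt_0 n); pose proof (INR_fact_lt_0 (2 * n)).
  pose proof (lt_0_INR n ltac:(lia)).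
  assert (0 < 4 ^ n) by (apply pow_lt; lra).
  assert (e4 : ln (4 ^ n) = 2 * INR n * ln 2).
  { replace 4 with (2 * 2) by lra.
    rewrite ln_pow, ln_mult by lra; ring. }
  rewrite wallis_even; unfold stirling.
  assert (hp : 0 < PI / 2) by lra.
  generalize dependent (PI / 2); intros p hp.
  rewrite ln_div, ln_mult, ln_mult, e4, ln_pow by
    (repeat apply Rmult_lt_0_compat; try apply pow_lt; lra).
  replace (INR (2 * n)) with (2 * INR n) by now rewrite mult_INR.
  rewrite (ln_mult 2) by lra; simpl (INR 2); field.
Qed.

Lemma stirling_wallis_bound (n : nat) : (1 <= n)%nat ->
  ln (sqrt (2 * PI)) <= 2 * stirling n - stirling (2 * n)
  <= ln (sqrt (2 * PI)) + 1 / (4 * INR n).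
Proof.
  intros hn; rewrite stirling_wallis by easy.
  pose proof PI_RGT_0.
  pose proof (lt_0_INR n ltac:(lia)).
  pose proof (wallis_even_pos n) as hw.
  destruct (wallis_even_sq n hn) as [h1 h2].
  apply ln_le in h1; [|apply Rdiv_lt_0_compat; lra].
  apply ln_le in h2; [|now apply pow_lt].
  rewrite ln_pow in h1, h2 by easy.
  assert (e4 : ln 4 = 2 * ln 2).
  { replace 4 with (2 * 2) by lra; rewrite ln_mult by lra; ring. }
  rewrite ln_div, ln_mult, e4 in h2 by lra.
  (* The two bounds on the squared integral differ by the factor [1 + 1/(2n)]; half its logarithm is
     at most the error [1/(4n)]. *)
  replace (2 * (2 * INR n + 1)) with (4 * (INR n * (1 + 1 / (2 * INR n)))) in h1
    by (field; lra).
  assert (0 < 1 / (2 * INR n)) by (apply Rdiv_lt_0_compat; lra).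
  assert (0 < INR n * (1 + 1 / (2 * INR n))) by (apply Rmult_lt_0_compat; lra).
  rewrite ln_div, ln_mult, ln_mult, e4 in h1 by lra.
  pose proof (ln_1p_le (1 / (2 * INR n)) ltac:(lra)).
  replace (1 / (4 * INR n)) with (/ 2 * (1 / (2 * INR n))) by (field; lra).
  assert (es : ln (sqrt (2 * PI)) = (ln 2 + ln PI) / 2).
  { rewrite <- ln_mult by lra.
    rewrite <- (sqrt_def (2 * PI)) at 2 by lra.
    rewrite ln_mult by (apply sqrt_lt_R0; lra); lra. }
  rewrite es, ln_div by lra.
  simpl (INR 2) in *; lra.
Qed.

(** Passage to the limit in [n]. The constant 2 makes room for two errors of size [1/n] in
    [robbins]: one from [stirling_limit], one from the end term of [stirling_sub]. *)
Lemma le_of_le_plus_div (x y : R) (m : nat) :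
  (forall n, (m <= n)%nat -> x <= y + 2 / INR n) -> x <= y.
Proof.
  intros h; apply Rnot_lt_le; intros hlt.
  destruct (archimed_cor1 ((x - y) / 2) ltac:(lra)) as [N [hN hN0]].
  specialize (h (N + m)%nat ltac:(lia)).
  assert (0 < INR N) by (apply lt_0_INR; lia).
  assert (/ INR (N + m) <= / INR N).
  { apply Rinv_le_contravar; [easy | apply le_INR; lia]. }
  unfold Rdiv in h; lra.
Qed.

(* [stirling n - c = (2 stirling n - stirling (2n) - c) - (stirling n - stirling (2n))]
   where [c = ln (sqrt (2 PI))]: both brackets are [O(1/n)]. *)
Lemma stirling_limit (n : nat) : (1 <= n)%nat ->
  Rabs (stirling n - ln (sqrt (2 * PI))) <= 1 / INR n.
Proof.
  intros hn.
  pose proof (lt_0_INR n ltac:(lia)).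
  pose proof (stirling_wallis_bound n hn).
  pose proof (stirling_sub n n hn) as hs.
  replace (n + n)%nat with (2 * n)%nat in hs by lia.
  rewrite mult_INR in hs; simpl (INR 2) in hs.
  assert (0 < / INR n) by now apply Rinv_0_lt_compat.
  replace (1 / (12 * INR n)) with (/ 12 * / INR n) in hs by (field; lra).
  replace (1 / (4 * INR n)) with (/ 4 * / INR n) in * by (field; lra).
  assert (0 < 1 / (12 * ((1 + 1) * INR n))) by (apply Rdiv_lt_0_compat; lra).
  assert (1 / (12 * ((1 + 1) * INR n) + 1) <= 1 / (12 * INR n + 1)).
  { apply Rmult_le_compat_l; [lra | apply Rinv_le_contravar; lra]. }
  unfold Rdiv in *; apply Rabs_le; lra.
Qed.

(** Let [n] tend to infinity in the telescoped bounds between [m] and [n]: [stirling n] tends to the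
    constant and the end terms at [n] vanish. *)
Lemma robbins (m : nat) : (1 <= m)%nat ->
  1 / (12 * INR m + 1) <= stirling m - ln (sqrt (2 * PI)) <= 1 / (12 * INR m).
Proof.
  intros hm; split; apply le_of_le_plus_div with m; intros n hn;
    pose proof (stirling_limit n ltac:(lia)) as hl; apply Rabs_le_between in hl;
    pose proof (stirling_sub m (n - m) hm) as hs;
    replace (m + (n - m))%nat with n in hs by lia;
    pose proof (lt_0_INR n ltac:(lia));
    assert (0 < / INR n) by now apply Rinv_0_lt_compat.
  - assert (1 / (12 * INR n + 1) <= 1 / INR n).
    { apply Rmult_le_compat_l; [lra | apply Rinv_le_contravar; lra]. }
    unfold Rdiv in *; lra.
  - assert (0 < 1 / (12 * INR n)) by (apply Rdiv_lt_0_compat; lra).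
    unfold Rdiv in *; lra.
Qed.

(** * Bounds on [h(u)], the logarithm of [e^u (1+u/k)^(-(k+1/2))] *)

Definition log_defect (k u : R) : R := u - (k + / 2) * (ln (k + u) - ln k).

Lemma log_defect_derive (k u : R) : 0 < k -> 0 <= u ->
  is_derive (fun u => log_defect k u - (u ^ 2 - u) / (4 * k)) u
    ((u - / 2) * (/ (k + u) - / (2 * k))).
Proof.
  intros hk hu; unfold log_defect; auto_derive; [lra | field; lra].
Qed.

(** From [u <= 1 <= k] follows [k + u <= 2k]. Hence the derivative above is nonpositive before
    [u = 1/2] and nonnegative after it. *)
Lemma log_defect_derive_factor (k u : R) : 1 <= k -> 0 <= u <= 1 ->
  0 <= / (k + u) - / (2 * k).
Proof.
  intros hk hu.
  assert (/ (2 * k) <= / (k + u)) by (apply Rinv_le_contravar; lra).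
  lra.
Qed.

Lemma log_defect_decr (k a b : R) : 1 <= k -> 0 <= a <= b -> b <= / 2 ->
  log_defect k b - (b ^ 2 - b) / (4 * k)
  <= log_defect k a - (a ^ 2 - a) / (4 * k).
Proof.
  intros hk ha hb; apply Ropp_le_cancel.
  apply (is_derive_nonneg_le
    (fun u => - (log_defect k u - (u ^ 2 - u) / (4 * k)))
    (fun u => - ((u - / 2) * (/ (k + u) - / (2 * k))))); [lra | |].
  - intros u hu.
    apply (is_derive_opp (V := R_NormedModule)), log_defect_derive; lra.
  - intros u hu; pose proof (log_defect_derive_factor k u hk ltac:(lra)); nra.
Qed.

Lemma log_defect_incr (k a b : R) : 1 <= k -> / 2 <= a <= b -> b <= 1 ->
  log_defect k a - (a ^ 2 - a) / (4 * k)
  <= log_defect k b - (b ^ 2 - b) / (4 * k).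
Proof.
  intros hk ha hb.
  apply (is_derive_nonneg_le
    (fun u => log_defect k u - (u ^ 2 - u) / (4 * k))
    (fun u => (u - / 2) * (/ (k + u) - / (2 * k)))); [lra | |].
  - intros u hu; apply log_defect_derive; lra.
  - intros u hu; pose proof (log_defect_derive_factor k u hk ltac:(lra)); nra.
Qed.

(** [log_defect k 1] is the negative of the Stirling increment, whose lower bound is positive. *)
Lemma log_defect_1_le (k : R) : 1 <= k -> log_defect k 1 <= 0.
Proof.
  intros hk; unfold log_defect.
  pose proof (stirling_step_lower k hk).
  assert (1 / (12 * (k + 1) + 1) <= 1 / (12 * k + 1)).
  { apply Rmult_le_compat_l; [lra | apply Rinv_le_contravar; lra]. }
  lra.
Qed.

Lemma mul_ln_1p_le (w : R) : 0 <= w -> (1 + w) * ln (1 + w) <= w + w ^ 2 / 2.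
Proof.
  intros hw.
  set (f := fun w => w + w ^ 2 / 2 - (1 + w) * ln (1 + w)).
  assert (h : f 0 <= f w).
  { apply is_derive_nonneg_le with (fun w => w - ln (1 + w)); [lra | |].
    - intros y hy; unfold f; auto_derive; [lra | field; lra].
    - intros y hy; pose proof (ln_1p_le y ltac:(lra)); lra. }
  unfold f in h; rewrite Rplus_0_r, ln_1 in h; lra.
Qed.

Lemma log_defect_half_ge (k : R) : 1 <= k -> - / (8 * k) <= log_defect k (/ 2).
Proof.
  intros hk; unfold log_defect.
  assert (0 < / (2 * k)) by (apply Rinv_0_lt_compat; lra).
  (* With [w = 1/(2k)] one has [k(1+w) = k + 1/2], so [k] times this inequality bounds the
     logarithmic term by [1/2 + 1/(8k)]. *)
  pose proof (mul_ln_1p_le (/ (2 * k)) ltac:(lra)) as h.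
  rewrite <- ln_div by lra.
  replace ((k + / 2) / k) with (1 + / (2 * k)) by (field; lra).
  apply (Rmult_le_compat_l k) in h; [|lra].
  replace (k * (/ (2 * k) + (/ (2 * k)) ^ 2 / 2)) with (/ 2 + / (8 * k)) in h
    by (field; lra).
  replace (k * ((1 + / (2 * k)) * ln (1 + / (2 * k)))) with
    ((k + / 2) * ln (1 + / (2 * k))) in h by (field; lra).
  lra.
Qed.

Lemma log_defect_bounds (k u : R) : 1 <= k -> 0 <= u <= 1 ->
  (u - / 2) ^ 2 / (4 * k) - / (8 * k) <= log_defect k u
  <= (u - / 2) ^ 2 / (4 * k) - / (16 * k).
Proof.
  intros hk hu.
  (* Completing the square costs [1/(16k)]. The shifted function is at least [-1/(16k)] at the
     midpoint and at most 0 at the end points. *)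
  replace ((u - / 2) ^ 2 / (4 * k)) with ((u ^ 2 - u) / (4 * k) + / (16 * k))
    by (field; lra).
  assert (e8 : / (8 * k) = 2 * / (16 * k)) by (field; lra).
  assert (e0 : log_defect k 0 = 0) by (unfold log_defect; rewrite Rplus_0_r; ring).
  assert (e1 : ((/ 2) ^ 2 - / 2) / (4 * k) = - / (16 * k)) by (field; lra).
  assert (e2 : (0 ^ 2 - 0) / (4 * k) = 0) by (field; lra).
  assert (e3 : (1 ^ 2 - 1) / (4 * k) = 0) by (field; lra).
  pose proof (log_defect_1_le k hk).
  pose proof (log_defect_half_ge k hk).
  destruct (Rle_lt_dec u (/ 2)).
  - pose proof (log_defect_decr k 0 u hk ltac:(lra) ltac:(lra)).
    pose proof (log_defect_decr k u (/ 2) hk ltac:(lra) ltac:(lra)).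
    lra.
  - pose proof (log_defect_incr k u 1 hk ltac:(lra) ltac:(lra)).
    pose proof (log_defect_incr k (/ 2) u hk ltac:(lra) ltac:(lra)).
    lra.
Qed.

(** * Integral representation of the approximation error *)

Lemma stieltjes_n_exp (k : nat) : stieltjes_n (exp (INR (k + 1))) = k.
Proof.
  unfold stieltjes_n, ceil; rewrite ln_exp.
  (* The logarithm is exactly the integer [k + 1], its own ceiling, so subtracting 1 gives [k]. *)
  rewrite <- (Int_part_spec _ (- Z.of_nat (k + 1))%Z).
  - lia.
  - rewrite opp_IZR, <- INR_IZR_INZ; lra.
Qed.

(** This is [- u * g' u] for [g u = k! e^(k+u) / (k+u)^(k+1)], because [g' = g (u-1)/(k+u)]. *)
Definition remainder (k : nat) (u : R) : R :=
  INR (fact k) * exp (INR k + u) * (u * (1 - u)) / (INR k + u) ^ (k + 2).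

Lemma continuous_remainder (k : nat) (u : R) : (1 <= k)%nat -> 0 <= u ->
  continuous (remainder k) u.
Proof.
  intros hk hu; pose proof (lt_0_INR k ltac:(lia)).
  apply (ex_derive_continuous (V := R_NormedModule)).
  unfold remainder; auto_derive; apply pow_nonzero; lra.
Qed.

(* Substitute [t = exp (k + u)], then integrate [u * g' u] by parts. *)
Lemma Delta_k_remainder (k : nat) : (1 <= k)%nat ->
  Delta_k (k + 1) = RInt (remainder k) 0 1.
Proof.
  intros hk; pose proof (lt_0_INR k ltac:(lia)) as hk0.
  unfold Delta_k, Stieltjes_Delta; rewrite stieltjes_n_exp, ln_exp.
  set (g := fun u => INR (fact k) * exp (INR k + u) / (INR k + u) ^ (k + 1)).
  assert (hg : is_RInt g 0 1
    (RInt (fun t => INR (fact k) / (ln t) ^ (k + 1))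
       (exp (INR k)) (exp (INR (k + 1))))).
  { rewrite plus_INR; rewrite <- (Rplus_0_r (INR k)) at 1.
    apply is_RInt_ext with
      (fun u => scal (exp (INR k + u))
         (INR (fact k) / (ln (exp (INR k + u))) ^ (k + 1))).
    { intros u _; unfold g, scal; simpl; unfold mult; simpl.
      rewrite ln_exp; unfold Rdiv; ring. }
    apply (is_RInt_comp (V := R_CompleteNormedModule)
      (fun t => INR (fact k) / (ln t) ^ (k + 1))
      (fun u => exp (INR k + u)) (fun u => exp (INR k + u)) 0 1);
      intros u; rewrite Rmin_left, Rmax_right by lra; intros hu.
    - apply (ex_derive_continuous (V := R_NormedModule)).
      auto_derive; rewrite ln_exp; split; [apply exp_pos|].
      split; [apply pow_nonzero; lra | trivial].
    - split; [auto_derive; [trivial | ring] |].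
      apply (ex_derive_continuous (V := R_NormedModule)).
      auto_derive; trivial. }
  (* The integrand is the derivative of [u * g u]. The boundary value [g 1] is precisely the term
     subtracted in [Stieltjes_Delta], where [ln x - n = 1]. *)
  assert (hd : is_RInt (fun u => minus (g u) (remainder k u)) 0 1
     (minus ((fun u => u * g u) 1) ((fun u => u * g u) 0))).
  { apply (is_RInt_derive (V := R_CompleteNormedModule)
      (fun u => u * g u));
      intros u; rewrite Rmin_left, Rmax_right by lra; intros hu.
    - unfold g, remainder; auto_derive; [apply pow_nonzero; lra |].
      replace (Init.Nat.pred (k + 1)) with k by lia.
      unfold minus, plus, opp; simpl.
      rewrite !pow_add, plus_INR; simpl; field.
      split; [lra | apply pow_nonzero; lra].
    - apply (continuous_minus (V := R_NormedModule));
        [|apply continuous_remainder; [easy | lra]].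
      apply (ex_derive_continuous (V := R_NormedModule)).
      unfold g; auto_derive; apply pow_nonzero; lra. }
  pose proof (is_RInt_minus (V := R_NormedModule) _ _ _ _ _ _ hg hd) as hm.
  assert (hr : is_RInt (remainder k) 0 1
    (minus (RInt (fun t => INR (fact k) / (ln t) ^ (k + 1))
       (exp (INR k)) (exp (INR (k + 1))))
       (minus ((fun u => u * g u) 1) ((fun u => u * g u) 0)))).
  { eapply is_RInt_ext; [|exact hm].
    intros u _; unfold minus, plus, opp; simpl; ring. }
  apply (is_RInt_unique (V := R_CompleteNormedModule)) in hr; rewrite hr.
  unfold minus, plus, opp, g; simpl; rewrite plus_INR; simpl (INR 1).
  unfold Rdiv; ring.
Qed.

(** * Comparison of the integrands and conclusion *)

Definition f_integrand (k : nat) (u : R) : R :=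
  exp ((u - 1 / 2) ^ 2 / (4 * INR k)) * (u * (1 - u)) / Rpower (INR k + u) (3 / 2).

(** Split the exponent [k + 2] of [k + u] as [(k + 1/2) + 3/2]: the first part goes into
    [log_defect], the second is the denominator of [f_integrand]. *)
Lemma remainder_eq (k : nat) (u : R) : (1 <= k)%nat -> 0 <= u ->
  remainder k u = sqrt (2 * PI)
    * exp (stirling k - ln (sqrt (2 * PI)) + log_defect (INR k) u
           - (u - 1 / 2) ^ 2 / (4 * INR k))
    * f_integrand k u.
Proof.
  intros hk hu; pose proof (lt_0_INR k ltac:(lia)) as hk0.
  pose proof PI_RGT_0; pose proof (INR_fact_lt_0 k).
  assert (0 < sqrt (2 * PI)) by (apply sqrt_lt_R0; lra).
  unfold remainder, f_integrand, Rpower.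
  rewrite <- (exp_ln (INR (fact k))) at 1 by easy.
  rewrite <- (exp_ln (sqrt (2 * PI))) at 1 by easy.
  rewrite <- (exp_ln ((INR k + u) ^ (k + 2))), ln_pow by
    (try apply pow_lt; lra).
  unfold Rdiv; rewrite <- !exp_Ropp.
  (* This factor can vanish, so it stays outside the exponential. *)
  set (q := u * (1 - u)).
  transitivity (exp (ln (INR (fact k)) + (INR k + u)
    - INR (k + 2) * ln (INR k + u)) * q).
  - unfold Rminus; rewrite !exp_plus; ring.
  - transitivity (exp (ln (sqrt (2 * PI)) + (stirling k - ln (sqrt (2 * PI))
      + log_defect (INR k) u - (u - 1 * / 2) ^ 2 * / (4 * INR k))
      + (u - 1 * / 2) ^ 2 * / (4 * INR k) - 3 * / 2 * ln (INR k + u)) * q).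
    + f_equal; f_equal; unfold stirling, log_defect.
      rewrite plus_INR; simpl (INR 2); field; lra.
    + unfold Rminus; rewrite !exp_plus; ring.
Qed.

Lemma f_integrand_nonneg (k : nat) (u : R) : 0 <= u <= 1 -> 0 <= f_integrand k u.
Proof.
  intros hu; unfold f_integrand.
  apply Rdiv_le_0_compat; [|apply exp_pos].
  apply Rmult_le_pos; [left; apply exp_pos | nra].
Qed.

Lemma ex_RInt_f_integrand (k : nat) : (1 <= k)%nat ->
  ex_RInt (f_integrand k) 0 1.
Proof.
  intros hk; pose proof (lt_0_INR k ltac:(lia)) as hk0.
  apply (ex_RInt_continuous (V := R_CompleteNormedModule)).
  intros u; rewrite Rmin_left, Rmax_right by lra; intros hu.
  apply (ex_derive_continuous (V := R_NormedModule)).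
  unfold f_integrand, Rpower; auto_derive.
  split; [lra | split; [apply Rgt_not_eq, exp_pos | trivial]].
Qed.

Lemma ex_RInt_remainder (k : nat) : (1 <= k)%nat -> ex_RInt (remainder k) 0 1.
Proof.
  intros hk; apply (ex_RInt_continuous (V := R_CompleteNormedModule)).
  intros u; rewrite Rmin_left, Rmax_right by lra; intros hu.
  apply continuous_remainder; [easy | lra].
Qed.

Lemma remainder_bounds (k : nat) (u : R) : (1 <= k)%nat -> 0 <= u <= 1 ->
  sqrt (2 * PI) * L_coef k * f_integrand k u <= remainder k u
  <= sqrt (2 * PI) * R_coef k * f_integrand k u.
Proof.
  intros hk hu; rewrite remainder_eq by (easy || lra).
  assert (1 <= INR k) by (apply (le_INR 1); lia).
  pose proof (f_integrand_nonneg k u hu).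
  pose proof (sqrt_pos (2 * PI)).
  pose proof (robbins k hk).
  pose proof (log_defect_bounds (INR k) u ltac:(easy) hu) as hb.
  replace (/ 2) with (1 / 2) in hb by lra.
  (* Source of [R_coef]: Robbins' [1/(12k)] less the [1/(16k)] from [log_defect_bounds]. [L_coef]
     arises likewise from [1/(12k+1)] and [1/(8k)]. *)
  assert (1 / (12 * INR k) = / (16 * INR k) + 1 / (48 * INR k)) by (field; lra).
  split; apply Rmult_le_compat_r; try easy; apply Rmult_le_compat_l; try easy;
    apply exp_monotone; unfold Rdiv in *; lra.
Qed.

Theorem lemma5 (k : nat) (hk : (1 <= k)%nat) :
  sqrt (2 * PI) * L_coef k * f_int k <= Delta_k (k + 1)
  /\ Delta_k (k + 1) <= sqrt (2 * PI) * R_coef k * f_int k.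
Proof.
  rewrite Delta_k_remainder by easy.
  change (f_int k) with (RInt (f_integrand k) 0 1).
  pose proof (ex_RInt_f_integrand k hk) as hf.
  pose proof (ex_RInt_remainder k hk) as hr.
  assert (hs : forall c, c * RInt (f_integrand k) 0 1
                         = RInt (fun u => c * f_integrand k u) 0 1).
  { intros c; symmetry.
    now apply (RInt_scal (V := R_CompleteNormedModule)). }
  assert (he : forall c, ex_RInt (fun u => c * f_integrand k u) 0 1).
  { intros c; now apply (ex_RInt_scal (V := R_NormedModule)). }
  rewrite !hs; split; apply RInt_le; auto; try lra;
    intros u hu; apply remainder_bounds; easy || lra.
Qed.
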